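(* For all integers $n,m\ge 1$, $$GM_{m+1}GM_n-GM_mGM_{n+1}=(2^{n-1}-2^{m-1})+3i\,(2^{n-1}-2^{m-1}).$$
   Context: The Gaussian Mersenne sequence $(GM_k)_{k\ge 0}$ of complex numbers is defined by $GM_0=-\frac{i}{2}$, $GM_1=1$ and $GM_{k+2}=3GM_{k+1}-2GM_k$ for $k\ge 0$, where $i$ is the imaginary unit. *)

(* Defs.v *)
From Stdlib Require Import Reals.
From Coquelicot Require Import Coquelicot.

Local Open Scope C_scope.

Fixpoint GM (k : nat) : C :=
  match k with
  | O => - (Ci / 2)
  | S k' =>
      match k' with
      | O => 1
      | S k'' => 3 * GM k' - 2 * GM k''
      end
  end.

(* Main.v *)
Require Import Defs.
From Stdlib Require Import Reals Lia.
From Coquelicot Require Import Coquelicot.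

(** The characteristic polynomial of the recurrence is X^2 - 3X + 2, with roots
    1 and 2, so GM k = A + B 2^k; the initial values force A = -(1 + i) and
    B = 1 + i/2 ([GM_binet]).  In the expression
    GM (m+1) GM n - GM m GM (n+1) the A^2 terms and the B^2 2^(m+n+1) terms
    cancel, and the cross terms leave A B (2^m - 2^n).  Since
    A B = -(1 + 3i)/2, this is (1 + 3i) (2^(n-1) - 2^(m-1)). *)

Local Open Scope C_scope.

Lemma Ci_sqr : Ci * Ci = -(1).
Proof. unfold Ci; apply injective_projections; simpl; ring. Qed.

Lemma GM_rec (k : nat) : GM (S (S k)) = 3 * GM (S k) - 2 * GM k.
Proof. reflexivity. Qed.

Lemma C2_neq_0 : (2 : C) <> 0.
Proof. intros H; apply RtoC_inj in H; revert H; apply eq_IZR_contrapositive; lia. Qed.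

Lemma GM_binet (k : nat) : GM k = (1 + Ci / 2) * 2 ^ k - (1 + Ci).
Proof.
  (* The recurrence has order two, so two consecutive values are carried. *)
  enough (H : GM k = (1 + Ci / 2) * 2 ^ k - (1 + Ci) /\
              GM (S k) = (1 + Ci / 2) * 2 ^ S k - (1 + Ci)) by apply H.
  induction k as [|k [IH0 IH1]].
  - split; simpl; field; exact C2_neq_0.
  - split; [exact IH1|].
    rewrite GM_rec, IH1, IH0, !Cpow_S.
    field; exact C2_neq_0.
Qed.

Theorem theorem3p4 :
  forall n m : nat, (1 <= n)%nat -> (1 <= m)%nat ->
    GM (m + 1) * GM n - GM m * GM (n + 1)
    = (2 ^ (n - 1) - 2 ^ (m - 1)) + 3 * Ci * (2 ^ (n - 1) - 2 ^ (m - 1)).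
Proof.
  intros n m Hn Hm.
  destruct n as [|n]; [lia|]; destruct m as [|m]; [lia|].
  replace (S n - 1)%nat with n by lia; replace (S m - 1)%nat with m by lia.
  rewrite !Nat.add_1_r, !GM_binet, !Cpow_S.
  set (x := 2 ^ m); set (y := 2 ^ n).
  (* The coefficient is - 2 A B = (1 + i) (2 + i), expanded before i^2 = -1 is
     used, because [field] does not know that identity. *)
  transitivity ((2 + 3 * Ci + Ci * Ci) * (y - x)).
  - field; exact C2_neq_0.
  - rewrite Ci_sqr; ring.
Qed.
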